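(* Let $\star$ be a nontrivial semistar operation of an integral domain $D$ with quotient field $K$, and let $\tilde{\star} := (\star_f)_{sp}$. For each $E \in \overline{\boldsymbol{F}}(D)$: (1) $E\,\mathrm{Na}(D,\star) = \bigcap\{E D_Q(X) \mid Q \in \mathcal{M}(\star_f)\}$. (2) $E\,\mathrm{Na}(D,\star) \cap K = \bigcap\{E D_Q \mid Q \in \mathcal{M}(\star_f)\}$. (3) $E^{\tilde{\star}} = E\,\mathrm{Na}(D,\star) \cap K$; hence if $E = E^\star$, then $E = E\,\mathrm{Na}(D,\star) \cap K$. (4) If $\star = \star_f$, then $\tilde{\star} = \star_{sp}$; hence $D^{\star_{sp}} = \bigcap\{D_Q \mid Q \in \mathcal{M}(\star)\}$, and $\star_{sp}$ is a semistar operation of finite type.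
   Context: $D$ is an integral domain with quotient field $K$. $\overline{\boldsymbol{F}}(D)$ is the set of nonzero $D$-submodules of $K$, and $\boldsymbol{f}(D)$ the set of nonzero finitely generated $D$-submodules of $K$. A semistar operation of $D$ is a map $\star : \overline{\boldsymbol{F}}(D) \to \overline{\boldsymbol{F}}(D)$, $E \mapsto E^\star$, such that for all $0 \neq z \in K$ and all $E, F \in \overline{\boldsymbol{F}}(D)$: $(zE)^\star = zE^\star$; $E \subseteq F \Rightarrow E^\star \subseteq F^\star$; $E \subseteq E^\star$ and $(E^\star)^\star = E^\star$. It is trivial if $E^\star = K$ for all $E$ (equivalently $D^\star = K$), and nontrivial otherwise. $E^{\star_f} := \bigcup\{F^\star \mid F \subseteq E,\ F \in \boldsymbol{f}(D)\}$; $\star$ is of finite type if $\star = \star_f$. For a semistar operation $\ast$, a quasi-$\ast$-ideal of $D$ is a nonzero ideal $I \subseteq D$ with $I^\ast \cap D = I$; a quasi-$\ast$-maximal ideal is a maximal element of the set of all proper quasi-$\ast$-ideals of $D$. For $\ast$ of finite type, $\mathcal{M}(\ast)$ denotes the set of quasi-$\ast$-maximal ideals of $D$ (these are prime ideals). For a semistar operation $\ast$, $\Pi^\ast := \{P \in \mathrm{Spec}(D) \mid P \neq 0,\ P^\ast \cap D \neq D\}$, and if $\Pi^\ast \neq \emptyset$, $\ast_{sp}$ is the semistar operation $E^{\ast_{sp}} := \bigcap\{ED_P \mid P \in \Pi^\ast\}$ ($\Pi^{\star_f}$ is nonempty when $\star$ is nontrivial). $\boldsymbol{c}(h)$ is the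 ideal of $D$ generated by the coefficients of $h \in D[X]$. $\mathrm{Na}(D,\star) := \{f/g \mid f,g \in D[X],\ g \neq 0,\ \boldsymbol{c}(g)^\star = D^\star\} \subseteq K(X)$. For a ring $R$, $R(X) := \{f/g \mid f,g \in R[X],\ \boldsymbol{c}(g) = R\}$ is its Nagata ring. For a subring $R'$ of $K(X)$ containing $D$, $ER'$ denotes the $R'$-submodule of $K(X)$ generated by $E$. *)

(* Defs.v *)
From mathcomp Require Import all_boot all_algebra.
From mathcomp Require Import all_classical.

Set Implicit Arguments.
Unset Strict Implicit.
Unset Printing Implicit Defensive.

Import GRing.Theory.
Local Open Scope classical_set_scope.
Local Open Scope ring_scope.

(* [R] is meant to be a subring of [L]; closure under opposite then follows
   from [-1 \in R]. *)
Definition submodule (L : fieldType) (R E : set L) : Prop :=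
  [/\ E 0,
      forall x y, E x -> E y -> E (x + y)
    & forall a x, R a -> E x -> E (a * x)].

Definition gen_submodule (L : fieldType) (R A : set L) : set L :=
  smallest (submodule R) A.

(* An integral domain is handled as a subset [D] of its quotient field [K], so
   that [D]-submodules of [K], ideals of [D] and overrings of [D] all have type
   [set K]. For [A : idomainType] this subset of [{fraction A}] is [base A]. *)
Definition base (A : idomainType) : set {fraction A} :=
  range (@FracField.tofrac A).
Arguments base A : clear implicits.

Section Domain.
Variables (K : fieldType) (D : set K).

Definition Fbar (E : set K) : Prop := submodule D E /\ E <> [set 0].

Definition fg (E : set K) : Prop :=
  Fbar E /\ exists2 A : set K, finite_set A & E = gen_submodule D A.

(* A map from [Fbar] to itself is represented by a function on all subsets of
   [K]; its values outside [Fbar] are unconstrained and never used. *)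
Record semistar (star : set K -> set K) : Prop := Semistar {
  semistar_Fbar : forall E, Fbar E -> Fbar (star E);
  semistar_scale : forall z E, z != 0 -> Fbar E ->
    star [set z * x | x in E] = [set z * x | x in star E];
  semistar_mono : forall E F, Fbar E -> Fbar F ->
    E `<=` F -> star E `<=` star F;
  semistar_ext : forall E, Fbar E -> E `<=` star E;
  semistar_idem : forall E, Fbar E -> star (star E) = star E }.

Definition trivial_star (star : set K -> set K) : Prop :=
  forall E, Fbar E -> star E = setT.

Definition star_fin (star : set K -> set K) (E : set K) : set K :=
  \bigcup_(F in [set F | fg F /\ F `<=` E]) star F.

Definition eq_star (star1 star2 : set K -> set K) : Prop :=
  forall E, Fbar E -> star1 E = star2 E.

Definition finite_type (star : set K -> set K) : Prop :=
  eq_star star (star_fin star).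

Definition ideal (I : set K) : Prop := submodule D I /\ I `<=` D.

Definition prime_ideal (P : set K) : Prop :=
  [/\ ideal P, P <> D
    & forall a b, D a -> D b -> P (a * b) -> P a \/ P b].

Definition quasi_ideal (star : set K -> set K) (I : set K) : Prop :=
  [/\ ideal I, I <> [set 0] & star I `&` D = I].

Definition quasi_maximal (star : set K -> set K) (Q : set K) : Prop :=
  [/\ quasi_ideal star Q, Q <> D
    & forall J, quasi_ideal star J -> J <> D -> Q `<=` J -> J = Q].

Definition Pi_star (star : set K -> set K) (P : set K) : Prop :=
  [/\ prime_ideal P, P <> [set 0] & star P `&` D <> D].

Definition localization (P : set K) : set K :=
  [set x | exists a s, [/\ D a, D s, ~ P s & x = a / s]].

(* If [Pi_star star] is empty this intersection is all of [K]. *)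
Definition star_sp (star : set K -> set K) (E : set K) : set K :=
  \bigcap_(P in Pi_star star) gen_submodule (localization P) E.

Definition star_tilde (star : set K -> set K) : set K -> set K :=
  star_sp (star_fin star).

End Domain.

Section Nagata.
Variable K : fieldType.

Definition ratfun : fieldType := {fraction {poly K}}.

Definition poly_ratfun (p : {poly K}) : ratfun := FracField.tofrac p.

Definition const_ratfun (x : K) : ratfun := poly_ratfun x%:P.

(* [R[X]] inside [K[X]], for a subring [R] of [K]. *)
Definition poly_over (R : set K) : set {poly K} :=
  [set f | forall i, R f`_i].

(* [range] also contains the zero coefficients beyond the degree, which do not
   change the generated ideal. *)
Definition content (R : set K) (g : {poly K}) : set K :=
  gen_submodule R (range (fun i : nat => g`_i)).

Definition Na (D : set K) (star : set K -> set K) : set ratfun :=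
  [set u | exists f g, [/\ poly_over D f, poly_over D g, g != 0,
    star (content D g) = star D & u = poly_ratfun f / poly_ratfun g]].

(* The Nagata ring [R(X)] of a subring [R] of [K]. *)
Definition nagata_ring (R : set K) : set ratfun :=
  [set u | exists f g, [/\ poly_over R f, poly_over R g,
    content R g = R & u = poly_ratfun f / poly_ratfun g]].

(* [E R'] for a subset [E] of [K] and a subring [R'] of [K(X)]. *)
Definition extend (E : set K) (R' : set ratfun) : set ratfun :=
  gen_submodule R' (const_ratfun @` E).

(* [U \cap K] for a subset [U] of [K(X)]. *)
Definition contract (U : set ratfun) : set K := const_ratfun @^-1` U.

End Nagata.

(* Main.v *)
Require Import Defs.
From mathcomp Require Import all_boot all_algebra.
From mathcomp Require Import all_classical.

(** Write [M] for the set of quasi-maximal ideals of the finite type operation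
    attached to [star], and [S] for the polynomials over [D] that have, for
    every [Q] in [M], a coefficient outside [Q].

    Everything rests on two facts.  First, a nonzero ideal of [D] whose
    [star_fin]-closure misses [1] lies in a member of [M]: finite type makes
    the quasi-ideals stable under unions of chains, so Zorn's lemma applies
    ([exists_quasi_maximal]).  Second, members of [M] are prime
    ([quasi_maximal_prime]).  By the first fact, a polynomial over [D] has
    content with the same closure as [D] exactly when it belongs to [S], so
    that [Na D star] is the ring of fractions [D[X]_S] ([NaE]).  By the second
    fact and Gauss's lemma, [S] is multiplicative; so is [D[X] \ Q[X]], whose
    ring of fractions is the Nagata ring of the localization at [Q]
    ([nagata_localization]).  For a multiplicative set [T], the submodule that
    [E] generates over [D[X]_T] consists of the fractions [h / g] with [h] in
    [E[X]] and [g] in [T] ([extend_fractions]).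

    For (1), let [u] be in every [E D_Q(X)].  The contents of the denominators
    [g] with [g u] in [E[X]] form a directed family, since the polynomial
    [g1 + X^n g2] with [n] large has the coefficients of both [g1] and [g2].
    Their union is contained in no [Q], so its [star_fin]-closure contains
    [1]; by finite type a single content already does, and that denominator
    is in [S] ([fractions_outside_all]).  Intersecting with [K] gives (2),
    because a constant [x] is in [E D_Q(X)] iff [s x] is in [E] for some [s]
    of [D] outside [Q], that is iff [x] is in [E D_Q].

    For (3), each prime of [Pi_star] lies below a member of [M], so the
    intersection defining [star_tilde] can be taken over [M]
    ([star_tildeE]).  If moreover [x g] is in [E[X]] with [g] in [S], then
    [x] is in [x D^star = (x c(g))^star], which is contained in [E^star]
    ([contract_fractions_star]).  For (4), [star] and [star_fin] have the same
    quasi-ideals and the same primes when they agree on nonzero submodules,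
    and a fraction [h / g] involves finitely many elements of [E], which gives
    finite type ([star_tilde_finite_type]). *)

Local Open Scope classical_set_scope.

(** * Generated submodules and directed unions *)

Section Submodules.

Local Open Scope ring_scope.
Import GRing.Theory.

Context {L : fieldType}.
Implicit Types (R M A : set L) (C : set (set L)).

Lemma gen_submoduleP R A : submodule R (gen_submodule R A).
Proof.
split.
- by move=> M [[]].
- move=> x y Ax Ay M HM; have [[_ MD _] _] := HM.
  by apply: MD; [apply: Ax|apply: Ay].
- move=> a x Ra Ax M HM; have [[_ _ MZ] _] := HM.
  by apply: MZ => //; apply: Ax.
Qed.

Lemma sub_gen R A : A `<=` gen_submodule R A.
Proof. exact: sub_gen_smallest. Qed.

Lemma gen_min R A M : submodule R M -> A `<=` M -> gen_submodule R A `<=` M.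
Proof. exact: smallest_sub. Qed.

Lemma gen_mono {R R' A A'} : R `<=` R' -> A `<=` A' ->
  gen_submodule R A `<=` gen_submodule R' A'.
Proof.
move=> RR' AA'; apply: gen_min; last by apply: subset_trans AA' (sub_gen _ _).
by have [G0 GD GZ] := gen_submoduleP R' A'; split=> // a x /RR'; apply: GZ.
Qed.

Lemma submodule_sum R M (I : Type) (r : seq I) (P : pred I) (F : I -> L) :
  submodule R M -> (forall i, P i -> M (F i)) ->
  M (\sum_(i <- r | P i) F i).
Proof. by move=> [M0 MD _] MF; apply: (big_ind M). Qed.

Lemma submodule_scale R M (z : L) :
  submodule R M -> submodule R [set z * x | x in M].
Proof.
move=> [M0 MD MZ]; split; first by exists 0; rewrite ?mulr0.
- by move=> _ _ [x Mx <-] [y My <-]; exists (x + y); [apply: MD|rewrite mulrDr].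
- by move=> a _ Ra [x Mx <-]; exists (a * x); [apply: MZ|rewrite mulrCA].
Qed.

Lemma submodule_preimage_scale R M (z : L) :
  submodule R M -> submodule R [set x | M (z * x)].
Proof.
move=> [M0 MD MZ]; split=> /=; first by rewrite mulr0.
- by move=> x y Mx My; rewrite mulrDr; apply: MD.
- by move=> a x Ra Mx; rewrite mulrCA; apply: MZ.
Qed.

Lemma gen_scale R A (z : L) :
  [set z * x | x in gen_submodule R A] =
  gen_submodule R [set z * x | x in A].
Proof.
apply/seteqP; split.
- move=> _ [x Ax <-]; move: x Ax; apply: gen_min.
    exact/submodule_preimage_scale/gen_submoduleP.
  by move=> x Ax; apply: sub_gen; exists x.
- apply: gen_min; first exact/submodule_scale/gen_submoduleP.
  by move=> _ [x Ax <-]; exists x => //; apply: sub_gen.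
Qed.

Definition directed C :=
  C !=set0 /\
  forall M N, C M -> C N -> exists2 P, C P & M `<=` P /\ N `<=` P.

Lemma submodule_bigcup_directed R C : directed C ->
  (forall M, C M -> submodule R M) -> submodule R (\bigcup_(M in C) M).
Proof.
move=> [[M0 CM0] dirC] Csub; split.
- by exists M0 => //; have [] := Csub _ CM0.
- move=> x y [M CM Mx] [N CN Ny]; have [P CP [MP NP]] := dirC _ _ CM CN.
  by exists P => //; have [_ + _] := Csub _ CP; apply; [apply: MP|apply: NP].
- by move=> a x Ra [M CM Mx]; exists M => //; have [_ _] := Csub _ CM; apply.
Qed.

(** The compactness behind every use of finite type: finitely many members of
    the family are dominated by a single one. *)
Lemma finite_sub_directed C A : finite_set A -> directed C ->
  A `<=` \bigcup_(M in C) M -> exists2 M, C M & A `<=` M.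
Proof.
move=> /finite_seqP[s ->] [[M0 CM0] dirC].
elim: s => [|x s IHs] sC; first by exists M0.
have [y /= sy|M CM sM] := IHs.
  by apply: sC; rewrite /= inE sy orbT.
have [|N CN Nx] := sC x; first by rewrite /= inE eqxx.
have [P CP [MP NP]] := dirC _ _ CM CN.
by exists P => // y /=; rewrite inE => /orP[/eqP->|/sM/MP//]; apply: NP.
Qed.

End Submodules.

(** * Polynomials with coefficients in a submodule, and their fractions *)

Section Polynomials.

Local Open Scope ring_scope.
Import GRing.Theory.

Context {K : fieldType}.
Implicit Types (R E : set K) (f g h : {poly K}) (T : set {poly K}).

Lemma finite_coefs g : finite_set (range (fun i : nat => g`_i)).
Proof.
apply: sub_finite_set (finite_seq (0 :: g)) => _ [i _ <-] /=; rewrite inE.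
by have [ig|gi] := ltnP i (size g); [rewrite mem_nth ?orbT|rewrite nth_default ?eqxx].
Qed.

Lemma coef_content R g i : content R g g`_i.
Proof. by apply: sub_gen; exists i. Qed.

Lemma content_sub R E g : submodule R E -> poly_over E g -> content R g `<=` E.
Proof. by move=> RE Eg; apply: gen_min => // _ [i _ <-]. Qed.

Lemma poly_overD R E f g : submodule R E ->
  poly_over E f -> poly_over E g -> poly_over E (f + g).
Proof. by move=> [_ ED _] Ef Eg i; rewrite coefD; apply: ED. Qed.

Lemma poly_overM R E f g : submodule R E ->
  poly_over R f -> poly_over E g -> poly_over E (f * g).
Proof.
move=> RE Rf Eg i; rewrite coefM; apply: (submodule_sum R) => // j _.
by case: RE => _ _; apply.
Qed.

Lemma poly_overC R E a : submodule R E -> E a -> poly_over E a%:P.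
Proof. by move=> [E0 _ _] Ea i; rewrite coefC; case: ifP. Qed.

Lemma poly_overXn R n : submodule R R -> R 1 -> poly_over R 'X^n.
Proof. by move=> [R0 _ _] R1 i; rewrite coefXn; case: (_ == _). Qed.

Lemma poly_ratfun_eq0 f : (poly_ratfun f == 0) = (f == 0).
Proof. exact: tofrac_eq0. Qed.

Lemma poly_ratfunM f g : poly_ratfun (f * g) = poly_ratfun f * poly_ratfun g.
Proof. exact: tofracM. Qed.

Lemma poly_ratfunD f g : poly_ratfun (f + g) = poly_ratfun f + poly_ratfun g.
Proof. exact: tofracD. Qed.

Lemma poly_ratfun_inj : injective (@poly_ratfun K).
Proof. by move=> f g /eqP; rewrite /poly_ratfun tofrac_eq => /eqP. Qed.

(** Writes [h] as a combination of constants, so that a submodule generated by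
    constants can be recognized to contain it. *)
Lemma poly_ratfun_expand h :
  poly_ratfun h =
  \sum_(i < size h) poly_ratfun 'X^i * const_ratfun h`_i.
Proof.
rewrite -[in LHS](coefK h) poly_def {1}/poly_ratfun rmorph_sum /=.
by apply: eq_bigr => i _; rewrite -mul_polyC -poly_ratfunM mulrC.
Qed.

(** [E[X]_T], for [E] a submodule that is not necessarily a ring: with [E] the
    base ring this is the ring of fractions, in general a module over it. *)
Definition fractions E T : set (ratfun K) :=
  [set u | exists h g,
    [/\ poly_over E h, T g & u = poly_ratfun h / poly_ratfun g]].

Lemma fractions_sub {E E' T T'} : E `<=` E' -> T `<=` T' ->
  fractions E T `<=` fractions E' T'.
Proof.
move=> EE' TT' _ [h [g [Eh Tg ->]]]; exists h, g.
by split; [move=> i; exact: EE'|exact: TT'|].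
Qed.

Definition mulset R T :=
  [/\ T `<=` poly_over R, forall g, T g -> g != 0, T 1
    & forall g1 g2, T g1 -> T g2 -> T (g1 * g2)].

(** Over a common denominator, a combination of elements of [E] with
    coefficients in [R[X]_T] has a numerator in [E[X]]; conversely [h / g] is
    the combination of the coefficients of [h] with weights [X^i / g]. *)
Lemma extend_fractions R E T : submodule R R -> R 1 -> submodule R E ->
  mulset R T -> extend E (fractions R T) = fractions E T.
Proof.
move=> RR R1 RE [TR T_neq0 T1 TM]; apply/seteqP; split.
- apply: gen_min; last first.
    move=> _ [x Ex <-]; exists x%:P, 1; split => //.
      exact: (poly_overC R).
    by rewrite [poly_ratfun 1]tofrac1 divr1.
  split.
  + exists 0, 1; split => //; first by move=> i; rewrite coef0; case: RE.
    by rewrite [poly_ratfun 0]tofrac0 mul0r.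
  + move=> _ _ [h1 [g1 [Eh1 Tg1 ->]]] [h2 [g2 [Eh2 Tg2 ->]]].
    exists (g2 * h1 + g1 * h2), (g1 * g2); split; [|exact: TM|].
      by apply: (poly_overD R) => //; apply: (poly_overM R) => //; apply: TR.
    rewrite poly_ratfunD !poly_ratfunM addf_div ?poly_ratfun_eq0 ?T_neq0 //.
    by congr (_ / _); rewrite mulrC [X in _ + X]mulrC [X in _ + X]mulrC.
  + move=> _ _ [f [g1 [Rf Tg1 ->]]] [h [g2 [Eh Tg2 ->]]].
    exists (f * h), (g1 * g2); split; [exact: (poly_overM R)|exact: TM|].
    by rewrite !poly_ratfunM mulf_div.
- move=> _ [h [g [Eh Tg ->]]].
  have mod_ext := gen_submoduleP (fractions R T) (@const_ratfun K @` E).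
  rewrite poly_ratfun_expand mulr_suml; apply: (submodule_sum _ _ _ _ _ _ mod_ext).
  move=> i _; rewrite mulrAC; have [_ _] := mod_ext; apply.
    by exists 'X^i, g; split => //; apply: poly_overXn.
  by apply: sub_gen; exists h`_i.
Qed.

(** [x = h / g] says [g * x = h], hence [x] multiplies each coefficient of [g]
    into [E]: the bridge from fractions of polynomials back to [K]. *)
Lemma const_fraction R E T x : submodule R E ->
  (forall g, T g -> g != 0) -> fractions E T (const_ratfun x) ->
  exists2 g, T g & forall i, E (g`_i * x).
Proof.
move=> RE T_neq0 [h [g [Eh Tg]]]; rewrite /const_ratfun => xE.
exists g => // i; suff -> : g`_i * x = h`_i by apply: Eh.
have gx_h : g * x%:P = h.
  apply: poly_ratfun_inj.
  by rewrite poly_ratfunM xE mulrC divfK // poly_ratfun_eq0 T_neq0.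
by rewrite -gx_h coefMC.
Qed.

End Polynomials.

(** * The finite type operation attached to a semistar operation *)

Section Semistar.

Local Open Scope ring_scope.
Import GRing.Theory.

Context {K : fieldType} {D : set K}.
Hypotheses (Dmod : submodule D D) (D1 : D 1).
Implicit Types (E F I J P Q A : set K).

Lemma FbarP E x : submodule D E -> E x -> x != 0 -> Fbar D E.
Proof.
move=> Emod Ex x0; split=> // E0; move: Ex x0.
by rewrite E0 /= => ->; rewrite eqxx.
Qed.

Lemma Fbar_neq0 E : Fbar D E -> exists2 x, E x & x != 0.
Proof.
move=> [[E0 _ _] En0]; apply: contrapT => noE; apply: En0.
apply/seteqP; split=> [x Ex|_ ->//] /=.
by apply: contrapT => /eqP x0; apply: noE; exists x.
Qed.

Lemma Fbar_D : Fbar D D.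
Proof. by apply: (FbarP D 1) => //; rewrite oner_neq0. Qed.

Lemma Fbar_scale z E : z != 0 -> Fbar D E -> Fbar D [set z * x | x in E].
Proof.
move=> z0 FE; have [x Ex x0] := Fbar_neq0 _ FE.
apply: (FbarP _ (z * x)); last by rewrite mulf_neq0.
  by apply: submodule_scale; case: FE.
by exists x.
Qed.

Lemma Fbar_fg F : fg D F -> Fbar D F.
Proof. by case. Qed.

Lemma fg_gen A x : finite_set A -> A x -> x != 0 -> fg D (gen_submodule D A).
Proof.
move=> finA Ax x0; split; last by exists A.
by apply: (FbarP _ x) => //; [apply: gen_submoduleP|apply: sub_gen].
Qed.

Lemma fg_scale z F : z != 0 -> fg D F -> fg D [set z * x | x in F].
Proof.
move=> z0 [FF [A finA FA]]; split; first exact: Fbar_scale.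
by exists [set z * x | x in A]; [apply: finite_image|rewrite FA gen_scale].
Qed.

Lemma fg_content g : g != 0 -> fg D (content D g).
Proof.
move=> g0; apply: (fg_gen _ (lead_coef g)).
- exact: finite_coefs.
- by exists (size g).-1.
- by rewrite lead_coef_eq0.
Qed.

(** The union of the generators of two finitely generated submodules of [E]
    generates an upper bound of both. *)
Lemma fg_below_directed E : Fbar D E ->
  directed [set F | fg D F /\ F `<=` E].
Proof.
move=> FE; split.
  have [x Ex x0] := Fbar_neq0 _ FE; exists (gen_submodule D [set x]).
  split; first by apply: (fg_gen _ x).
  by apply: gen_min => [|_ ->//]; case: FE.
move=> F1 F2 [[FF1 [A1 finA1 ->]] F1E] [[FF2 [A2 finA2 F2A]] F2E].
rewrite {}F2A in FF2 F2E *.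
exists (gen_submodule D (A1 `|` A2)); last first.
  by split; apply: gen_mono.
split; last first.
  apply: gen_min; first by case: FE.
  by move=> x [] Ax; [apply: F1E|apply: F2E]; apply: sub_gen.
split; last by exists (A1 `|` A2) => //; rewrite finite_setU.
have [x Ax x0] := Fbar_neq0 _ FF2.
apply: (FbarP _ x) => //; first exact: gen_submoduleP.
by move: x Ax {x0}; apply: gen_mono => // x ?; right.
Qed.

Lemma fg_sub_directed F (C : set (set K)) : fg D F -> directed C ->
  (forall M, C M -> submodule D M) -> F `<=` \bigcup_(M in C) M ->
  exists2 M, C M & F `<=` M.
Proof.
move=> [_ [A finA ->]] dirC Cmod FC.
have [|M CM AM] := finite_sub_directed _ _ finA dirC.
  exact: subset_trans (sub_gen _ _) FC.
by exists M => //; apply: gen_min => //; apply: Cmod.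
Qed.

Section Operation.

Context {star : set K -> set K}.
Hypothesis star_ss : semistar D star.

Let sub_star E F : Fbar D E -> Fbar D F -> E `<=` star F -> star E `<=` star F.
Proof.
move=> FE FF EF; rewrite -(semistar_idem star_ss FF).
by apply: (semistar_mono star_ss) => //; apply: (semistar_Fbar star_ss).
Qed.

Lemma star_fin_directed E : Fbar D E ->
  directed (star @` [set F | fg D F /\ F `<=` E]).
Proof.
move=> FE; have [[F0 EF0] dirE] := fg_below_directed _ FE; split.
  by exists (star F0); exists F0.
move=> _ _ [F1 EF1 <-] [F2 EF2 <-]; have [F EF [F1F F2F]] := dirE _ _ EF1 EF2.
exists (star F); first by exists F.
have Ff := Fbar_fg _ EF.1.
by split; apply: (semistar_mono star_ss) => //; apply: Fbar_fg;
  [case: EF1|case: EF2].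
Qed.

Lemma star_below_submodule E M :
  (star @` [set F | fg D F /\ F `<=` E]) M -> submodule D M.
Proof. by move=> [F [[FF _] _] <-]; case: (semistar_Fbar star_ss FF). Qed.

Lemma star_finE E :
  star_fin D star E = \bigcup_(M in star @` [set F | fg D F /\ F `<=` E]) M.
Proof. by rewrite bigcup_image. Qed.

Lemma star_fin_mono E F : E `<=` F -> star_fin D star E `<=` star_fin D star F.
Proof.
by move=> EF x [G [fgG GE] Gx]; exists G => //; split=> //; apply: subset_trans EF.
Qed.

Lemma star_fin_sub E : Fbar D E -> star_fin D star E `<=` star E.
Proof.
by move=> FE x [F [/Fbar_fg FF FE'] Fx]; apply: (semistar_mono star_ss) Fx.
Qed.

Lemma star_fin_ext E : Fbar D E -> E `<=` star_fin D star E.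
Proof.
move=> FE x Ex; have [y Ey y0] := Fbar_neq0 _ FE.
have fgF : fg D (gen_submodule D [set x; y]).
  by apply: (fg_gen _ y) => //; right.
exists (gen_submodule D [set x; y]).
  by split=> //; apply: gen_min => [|_ [->|->]//]; case: FE.
by apply: (semistar_ext star_ss (Fbar_fg _ fgF)); apply: sub_gen; left.
Qed.

(** Idempotence is the point: the finitely many generators of a submodule of
    the closure of [E] lie in [star G] for one finitely generated [G] inside
    [E], by directedness. *)
Lemma star_fin_semistar : semistar D (star_fin D star).
Proof.
have finF E : Fbar D E -> Fbar D (star_fin D star E).
  move=> FE; have [x Ex x0] := Fbar_neq0 _ FE.
  apply: (FbarP _ x) => //; last exact: star_fin_ext.
  rewrite star_finE; apply: submodule_bigcup_directed; first exact: star_fin_directed.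
  exact: star_below_submodule.
have scale_sub z E : z != 0 -> Fbar D E ->
    [set z * x | x in star_fin D star E] `<=`
    star_fin D star [set z * x | x in E].
  move=> z0 FE _ [x [F [fgF FE'] Fx] <-]; exists [set z * y | y in F].
    by split; [apply: fg_scale|apply: image_subset].
  by rewrite (semistar_scale star_ss z0 (Fbar_fg _ fgF)); exists x.
split=> //.
- move=> z E z0 FE; apply/seteqP; split; last exact: scale_sub.
  have zK G : [set z^-1 * x | x in [set z * y | y in G]] = G.
    rewrite image_comp (_ : _ \o _ = id) ?image_id //.
    by apply/funext => y /=; rewrite mulKf.
  move=> x fx; exists (z^-1 * x); last by rewrite mulVKf.
  rewrite -[E]zK; apply: scale_sub; rewrite ?invr_neq0 //.
    exact: Fbar_scale.
  by exists x.
- by move=> E F _ _; apply: star_fin_mono.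
- exact: star_fin_ext.
- move=> E FE; apply/seteqP; split; last by apply: star_fin_ext; apply: finF.
  move=> x [F [fgF FE'] Fx]; rewrite star_finE in FE'.
  have [_ [G GE <-] FG] :=
    fg_sub_directed _ _ fgF (star_fin_directed _ FE) (star_below_submodule E) FE'.
  exists G => //; have [/Fbar_fg FG' _] := GE.
  exact: (sub_star _ _ (Fbar_fg _ fgF) FG' FG _ Fx).
Qed.

(** * Quasi-maximal ideals *)

Let starf := star_fin D star.

Lemma ideal_proper I : ideal D I -> I <> D <-> ~ I 1.
Proof.
move=> [[_ _ IZ] ID]; split=> [InD I1|nI1 IeD]; last by apply: nI1; rewrite IeD.
by apply: InD; apply/seteqP; split=> // a Da; rewrite -[a]mulr1; apply: IZ.
Qed.

(** Turns the properness condition of [Pi_star] into the absence of [1], the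
    form in which finite type can be exploited. *)
Lemma star_fin_proper I : Fbar D I -> starf I `&` D <> D <-> ~ starf I 1.
Proof.
move=> FI; have [[_ _ IZ] _] := semistar_Fbar star_fin_semistar FI.
split=> [ID I1|nI1 ID]; last by apply: nI1; have := D1; rewrite -[X in X 1]ID => -[].
apply: ID; apply/seteqP; split=> [x []//|a Da]; split=> //.
by rewrite -[a]mulr1; apply: IZ.
Qed.

(** Contracting the closure to [D] gives the least quasi-ideal above [I]; it
    is proper as soon as the closure misses [1]. *)
Lemma quasi_closure I : Fbar D I -> I `<=` D -> ~ starf I 1 ->
  [/\ quasi_ideal D starf (starf I `&` D), starf I `&` D <> D & I `<=` starf I `&` D].
Proof.
move=> FI ID nI1; have fss := star_fin_semistar.
have FfI := semistar_Fbar fss FI.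
have IfI : I `<=` starf I `&` D.
  by move=> x Ix; split; [exact: (semistar_ext fss FI)|apply: ID].
have Fc : Fbar D (starf I `&` D).
  have [x Ix x0] := Fbar_neq0 _ FI; apply: (FbarP _ x) => //; last exact: IfI.
  case: FfI Dmod => [[f0 fD fZ] _] [D0 DD DZ]; split; first by split.
  - by move=> a b [fa Da] [fb Db]; split; [apply: fD|apply: DD].
  - by move=> a b Da [fb Db]; split; [apply: fZ|apply: DZ].
split=> //; last by apply/star_fin_proper.
split; [by split; [case: Fc|move=> x []]|by case: Fc|].
apply/seteqP; split=> x [fx Dx]; split=> //.
  rewrite /starf -(semistar_idem fss FI).
  by move: x fx {Dx}; apply: (semistar_mono fss) => // y [].
by apply: (semistar_ext fss).
Qed.

(** Zorn's lemma.  A finitely generated submodule of the union of a chain of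
    quasi-ideals lies in one of them, so the closure of the union creates no
    new element of [D], in particular not [1]. *)
Lemma exists_quasi_maximal I : Fbar D I -> I `<=` D -> ~ starf I 1 ->
  exists2 Q, quasi_maximal D starf Q & I `<=` Q.
Proof.
move=> FI ID nI1; have fss := star_fin_semistar.
have [] := quasi_closure _ FI ID nI1; set J := starf I `&` D => qJ JD IJ.
pose proper_quasi Q := quasi_ideal D starf Q /\ Q <> D.
have [B [pB maxB]] : exists B, proper_quasi (J `|` B) /\
    forall B', B `<` B' -> ~ proper_quasi (J `|` B').
  (* The union with [J] makes the empty chain harmless: its union yields [J]. *)
  apply: (@Zorn_bigcup _ (fun B => proper_quasi (J `|` B))) => F Fpq totF.
  pose C := [set Q | Q = J \/ exists2 B, F B & Q = J `|` B].
  have Cpq Q : C Q -> proper_quasi Q by move=> [->|[B /Fpq ? ->]].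
  have -> : J `|` \bigcup_(B in F) B = \bigcup_(Q in C) Q.
    apply/seteqP; split=> x.
      move=> [Jx|[B FB Bx]]; first by exists J; [left|].
      by exists (J `|` B); [right; exists B|right].
    by move=> [_ [->|[B FB ->]]]; [left|move=> [|Bx]; [left|right; exists B]].
  have dirC : directed C.
    split; first by exists J; left.
    have JC Q : C Q -> J `<=` Q by move=> [->|[B _ ->]] // x; left.
    move=> P Q [->|[B1 FB1 ->]] CQ; first by exists Q => //; split=> //; apply: JC.
    have CB1 : C (J `|` B1) by right; exists B1.
    case: CQ => [->|[B2 FB2 ->]].
      by exists (J `|` B1) => //; split=> // x; left.
    have [B12|B21] := totF _ _ FB1 FB2.
      by exists (J `|` B2); [right; exists B2|split=> //; apply: setUS].
    by exists (J `|` B1) => //; split=> //; apply: setUS.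
  have Cmod Q : C Q -> submodule D Q by case/Cpq => [[[]]].
  have UD : \bigcup_(Q in C) Q `<=` D.
    by move=> x [Q /Cpq[[[_ QD] _ _] _] /QD].
  have Uid : ideal D (\bigcup_(Q in C) Q).
    by split=> //; apply: submodule_bigcup_directed.
  have JU : J `<=` \bigcup_(Q in C) Q by move=> x Jx; exists J => //; left.
  have U0 : \bigcup_(Q in C) Q <> [set 0].
    move=> U0; have [x Ix x0] := Fbar_neq0 _ FI.
    by have := JU x (IJ x Ix); rewrite U0 /=; apply/eqP.
  split; last first.
    apply/(ideal_proper _ Uid) => -[Q CQ Q1]; have [[Qid _ _] QD] := Cpq _ CQ.
    by move/(ideal_proper _ Qid): QD.
  split=> //; apply/seteqP; split=> [x [[G [fgG GU] Gx] Dx]|x Ux]; last first.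
    by split; [exact: (semistar_ext fss (conj Uid.1 U0))|exact: UD].
  have [Q CQ GQ] := fg_sub_directed _ _ fgG dirC Cmod GU.
  have [[_ _ QE] _] := Cpq _ CQ.
  by exists Q => //; rewrite -QE; split=> //; exists G.
have [qB BD] := pB; exists (J `|` B); last by move=> x /IJ; left.
split=> // Q qQ QD JBQ.
have JUQ : J `|` Q = Q by apply/setUidPr => x Jx; apply: JBQ; left.
apply/seteqP; split=> // x Qx; right; apply: contrapT => nBx.
apply: (maxB Q); last by rewrite JUQ.
by split; [move=> y By; apply: JBQ; right|move/(_ x Qx)].
Qed.

Lemma quasi_maximal_not1 Q : quasi_maximal D starf Q -> ~ starf Q 1.
Proof.
move=> [[Qid _ QE] QD _] fQ1; move/(ideal_proper _ Qid): QD; apply.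
by rewrite -QE; split.
Qed.

Lemma quasi_maximal_Fbar Q : quasi_maximal D starf Q -> Fbar D Q.
Proof. by move=> [[[Qmod _] Q0 _] _ _]. Qed.

(** Let [a * b] be in [Q] and [a] not.  By maximality the closure of
    [I = Q + a D] contains [1], hence so does [star F] for a finitely generated
    [F] inside [I].  Then [b] is in [star (b F)], and [b F] is contained in
    [b Q + a b D], hence in [Q]. *)
Lemma quasi_maximal_prime Q : quasi_maximal D starf Q -> prime_ideal D Q.
Proof.
move=> mQ; have FQ := quasi_maximal_Fbar _ mQ.
have [[Qid Q0 QE] QD maxQ] := mQ; split=> // a b Da Db Qab.
have [Qmod QsubD] := Qid; have [Q00 QA QZ] := Qmod.
apply: contrapT => /not_orP[nQa nQb].
pose I := [set x | exists q c, [/\ Q q, D c & x = q + c * a]].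
have QI : Q `<=` I.
  by move=> q Qq; exists q, 0; split=> //; [case: Dmod|rewrite mul0r addr0].
have Ia : I a by exists 0, 1; split=> //; rewrite mul1r add0r.
have FI : Fbar D I.
  have [x Qx x0] := Fbar_neq0 _ FQ; apply: (FbarP _ x) => //; last exact: QI.
  have [D0 DA DM] := Dmod; split; first exact: QI.
  - move=> _ _ [q1 [c1 [Qq1 Dc1 ->]]] [q2 [c2 [Qq2 Dc2 ->]]].
    exists (q1 + q2), (c1 + c2); split; [exact: QA|exact: DA|].
    by rewrite mulrDl addrACA.
  - move=> d _ Dd [q [c [Qq Dc ->]]]; exists (d * q), (d * c).
    by split; [exact: QZ|exact: DM|rewrite mulrDr mulrA].
have ID : I `<=` D.
  move=> _ [q [c [Qq Dc ->]]]; have [_ DA DM] := Dmod.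
  by apply: DA; [apply: QsubD|apply: DM].
have [[F [fgF FsubI] F1]|nI1] := EM (starf I 1); last first.
  have [qI' I'D II'] := quasi_closure _ FI ID nI1.
  apply: nQa; rewrite -(maxQ _ qI' I'D); first exact: II'.
  exact: subset_trans QI II'.
have b0 : b != 0 by apply/eqP => b0; apply: nQb; rewrite b0.
apply: nQb; rewrite -QE; split=> //.
exists [set b * x | x in F].
  split; first exact: fg_scale.
  move=> _ [x /FsubI[q [c [Qq Dc ->]]] <-]; rewrite mulrDr.
  by apply: QA; [apply: QZ|rewrite mulrCA [b * a]mulrC; apply: QZ].
by rewrite (semistar_scale star_ss b0 (Fbar_fg _ fgF)); exists 1 => //; rewrite mulr1.
Qed.

(** If [star D] misses the fraction [a / b], then [star (b D) = b (star D)]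
    misses [1], so [b D] lies in a quasi-maximal ideal. *)
Lemma exists_quasi_maximal_nontrivial :
  (forall x : K, exists a b, [/\ D a, D b, b != 0 & x = a / b]) ->
  ~ trivial_star D star -> exists Q, quasi_maximal D starf Q.
Proof.
move=> Dfrac nontriv; have [starD|/existsNP[x nDx]] := EM (forall x, star D x).
  case: nontriv => E FE; apply/seteqP; split=> // x _.
  have [e Ee e0] := Fbar_neq0 _ FE.
  have : star [set e * y | y in D] x.
    rewrite (semistar_scale star_ss e0 Fbar_D).
    by exists (e^-1 * x) => //; rewrite mulVKf.
  move: x; apply: (semistar_mono star_ss) => //.
    exact: Fbar_scale Fbar_D.
  by move=> _ [d Dd <-]; rewrite mulrC; have [[_ _ +] _] := FE; apply.
have [a [b [Da Db b0 xE]]] := Dfrac x.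
have FbD := Fbar_scale _ _ b0 Fbar_D.
have [|bD1|Q mQ _] := exists_quasi_maximal _ FbD; last by exists Q.
  by move=> _ [d Dd <-]; have [_ _] := Dmod; apply.
have := star_fin_sub _ FbD _ bD1.
rewrite (semistar_scale star_ss b0 Fbar_D) => -[y Dy by1]; apply: nDx.
have -> : x = a * y.
  by apply: (mulfI b0); rewrite xE [RHS]mulrCA by1 mulrCA divff.
by have [[_ _ +] _] := semistar_Fbar star_ss Fbar_D; apply.
Qed.

End Operation.

End Semistar.

(** * Localizations at primes and their Nagata rings *)

Section Localization.

Local Open Scope ring_scope.
Import GRing.Theory.

Context {K : fieldType} {D : set K}.
Hypotheses (Dmod : submodule D D) (D1 : D 1).
Implicit Types (E P : set K) (f g : {poly K}).

Lemma prime_ideal_not1 P : prime_ideal D P -> ~ P 1.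
Proof. by move=> [Pid /(ideal_proper D1 _ Pid)]. Qed.

Lemma prime_ideal_compl_neq0 P s : prime_ideal D P -> ~ P s -> s != 0.
Proof. by move=> [[[P0 _ _] _] _ _] nPs; apply/eqP => s0; apply: nPs; rewrite s0. Qed.

Lemma prime_ideal_complM P s t : prime_ideal D P ->
  D s -> D t -> ~ P s -> ~ P t -> ~ P (s * t).
Proof. by move=> [_ _ PM] Ds Dt nPs nPt /(PM _ _ Ds Dt)[]. Qed.

Lemma sub_localization P : prime_ideal D P -> D `<=` localization D P.
Proof.
by move=> Pp x Dx; exists x, 1; split; rewrite ?divr1 //; apply: prime_ideal_not1.
Qed.

(** Elements of [E D_P] have a single denominator outside [P]; this reduces all
    statements on localizations to memberships in [E]. *)
Lemma gen_localizationP P E x : prime_ideal D P -> submodule D E ->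
  gen_submodule (localization D P) E x <->
  exists s, [/\ D s, ~ P s & E (s * x)].
Proof.
move=> Pp Emod; have [E0 EA EZ] := Emod; have [_ _ DM] := Dmod; split.
- move: x; apply: gen_min; last first.
    by move=> x Ex; exists 1; split; rewrite ?mul1r //; apply: prime_ideal_not1.
  split.
  + by exists 1; rewrite mulr0; split=> //; apply: prime_ideal_not1.
  + move=> x y [s [Ds nPs Ex]] [t [Dt nPt Ey]]; exists (s * t); split.
    * exact: DM.
    * exact: prime_ideal_complM.
    * rewrite mulrDr [X in X + _]mulrAC [X in X + _]mulrC -[X in _ + X]mulrA.
      by apply: EA; apply: EZ.
  + move=> _ x [a [t [Da Dt nPt ->]]] [s [Ds nPs Ex]]; exists (t * s); split.
    * exact: DM.
    * exact: prime_ideal_complM.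
    * have t0 := prime_ideal_compl_neq0 _ _ Pp nPt.
      suff -> : t * s * (a / t * x) = a * (s * x) by apply: EZ.
      by rewrite mulrACA [t * _]mulrC divfK.
- move=> [s [Ds nPs Esx]]; have s0 := prime_ideal_compl_neq0 _ _ Pp nPs.
  have [_ _ GZ] := gen_submoduleP (localization D P) E.
  rewrite -[x](mulKf s0); apply: GZ; last exact: sub_gen.
  by exists 1, s; split; rewrite ?div1r.
Qed.

Lemma gen_localization_D P : prime_ideal D P ->
  gen_submodule (localization D P) D = localization D P.
Proof.
move=> Pp; apply/seteqP; split=> [x|x [a [s [Da Ds nPs ->]]]].
  move/(gen_localizationP _ _ _ Pp Dmod) => [s [Ds nPs Dsx]].
  exists (s * x), s; split => //.
  by rewrite mulrC mulKf // (prime_ideal_compl_neq0 P).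
apply/(gen_localizationP _ _ _ Pp Dmod); exists s; split=> //.
by rewrite mulrC divfK // (prime_ideal_compl_neq0 P).
Qed.

Lemma localization_submodule P : prime_ideal D P ->
  submodule (localization D P) (localization D P).
Proof.
by move=> Pp; rewrite -[X in submodule _ X]gen_localization_D //; apply: gen_submoduleP.
Qed.

Lemma localization_anti P Q : P `<=` Q -> localization D Q `<=` localization D P.
Proof.
by move=> PQ x [a [s [Da Ds nQs ->]]]; exists a, s; split=> // /PQ.
Qed.

(** The multiplicative set [D[X] \ P[X]]. *)
Definition outside P : set {poly K} :=
  [set g | poly_over D g /\ exists i, ~ P g`_i].

Lemma coef_outside_min P g : (exists i, ~ P g`_i) ->
  exists i, ~ P g`_i /\ forall j, (j < i)%N -> P g`_j.
Proof.
move=> [i nPi]; have exP : exists i, `[< ~ P g`_i >] by exists i; apply/asboolP.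
case: (ex_minnP exP) => m /asboolP nPm min_m; exists m; split=> // j jm.
apply: contrapT => /asboolP /min_m; by rewrite leqNgt jm.
Qed.

(** Gauss's lemma: if [m] and [n] are the least indices of a coefficient outside
    [P] in [f] and [g], the coefficient of [f * g] of index [m + n] is the
    product of these two modulo [P]. *)
Lemma outsideM P f g : D (- 1) -> prime_ideal D P ->
  outside P f -> outside P g -> outside P (f * g).
Proof.
move=> DN1 Pp [Df /coef_outside_min[m [nPm fP]]] [Dg /coef_outside_min[n [nPn gP]]].
split; first exact: (poly_overM D).
exists (m + n)%N; rewrite coefM => Pmn.
have [[Pmod PD] _ _] := Pp; have [P0 PA PZ] := Pmod.
have mmn : (m < (m + n).+1)%N by rewrite ltnS leq_addr.
apply: (prime_ideal_complM _ _ _ Pp (Df m) (Dg n) nPm nPn).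
rewrite (bigD1 (Ordinal mmn)) //= addKn in Pmn.
set S := \sum_(i < _ | _) _ in Pmn.
have PS : P S.
  apply: (submodule_sum D) => // i /eqP/val_eqP /= im.
  have [ltim|] := ltnP i m; first by rewrite mulrC; apply: PZ; [apply: Dg|apply: fP].
  rewrite leq_eqVlt eq_sym (negPf im) /= => ltmi.
  by apply: PZ; [apply: Df|apply: gP; rewrite ltn_subLR ?ltn_add2r // -ltnS].
by rewrite -[_ * _](addrK S); apply: PA => //; rewrite -mulN1r; apply: PZ.
Qed.

Lemma outside_mulset P : D (- 1) -> prime_ideal D P -> mulset D (outside P).
Proof.
move=> DN1 Pp; have [[[P0 _ _] _] _ _] := Pp; split.
- by move=> g [].
- by move=> g [_ [i nPi]]; apply/eqP => g0; apply: nPi; rewrite g0 coef0.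
- split; first by apply: (poly_overC D) => //.
  by exists 0%N; rewrite coefC /=; apply: prime_ideal_not1.
- by move=> g1 g2; apply: outsideM.
Qed.

Lemma common_denominator P f : prime_ideal D P ->
  poly_over (localization D P) f ->
  exists d, [/\ D d, ~ P d & poly_over D (d%:P * f)].
Proof.
move=> Pp Lf; have [D0 _ DM] := Dmod.
suff [d [Dd nPd Ddf]] :
    exists d, [/\ D d, ~ P d & forall i, (i < size f)%N -> D (d * f`_i)].
  exists d; split=> // i; rewrite coefCM.
  by have [/Ddf//|fi] := ltnP i (size f); rewrite nth_default ?mulr0.
elim: (size f) => [|n [d [Dd nPd IHd]]].
  by exists 1; split=> //; apply: prime_ideal_not1.
have [a [s [Da Ds nPs fnE]]] := Lf n; exists (s * d); split.
- exact: DM.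
- exact: prime_ideal_complM.
- move=> i; rewrite ltnS leq_eqVlt => /orP[/eqP->|/IHd Di].
    rewrite fnE mulrC mulrA divfK ?(prime_ideal_compl_neq0 P) //.
    exact: DM.
  by rewrite -mulrA; apply: DM.
Qed.

(** Clearing denominators outside [P] turns a fraction over [D_P] into one over
    [D].  A denominator of unit content keeps a coefficient outside [P], since
    otherwise [1] would lie in [P D_P]; conversely a coefficient outside [P] is
    a unit of [D_P]. *)
Lemma nagata_localization P : prime_ideal D P ->
  nagata_ring (localization D P) = fractions D (outside P).
Proof.
move=> Pp; have [[Pmod PD] _ _] := Pp; apply/seteqP; split.
- move=> _ [f [g [Lf Lg cg ->]]].
  have [d [Dd nPd Ddf]] := common_denominator _ _ Pp Lf.
  have [e [De nPe Deg]] := common_denominator _ _ Pp Lg.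
  have c0 a : ~ P a -> a%:P != 0 :> {poly K}.
    by rewrite polyC_eq0; apply: prime_ideal_compl_neq0.
  exists (e%:P * (d%:P * f)), (d%:P * (e%:P * g)); split.
  + by apply: (poly_overM D) => //; apply: (poly_overC D).
  + split; first by apply: (poly_overM D) => //; apply: (poly_overC D).
    apply: contrapT => /forallNP Pg.
    have cgP : content (localization D P) g `<=` gen_submodule (localization D P) P.
      apply: content_sub; first exact: gen_submoduleP.
      move=> i; apply/(gen_localizationP _ _ _ Pp Pmod).
      exists (d * e); split; first by case: Dmod => _ _; apply.
        exact: prime_ideal_complM.
      by have := Pg i; rewrite !coefCM mulrA => /contrapT.
    have : gen_submodule (localization D P) P 1.
      by apply: cgP; rewrite cg; apply: sub_localization.
    by move=> /(gen_localizationP _ _ _ Pp Pmod)[s []]; rewrite mulr1.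
  + rewrite !poly_ratfunM !mulrA [poly_ratfun e%:P * _]mulrC -mulf_div divff ?mul1r //.
    by rewrite mulf_neq0 ?poly_ratfun_eq0 ?c0.
- move=> _ [f [g [Df [Dg [i nPi]] ->]]].
  have DL := sub_localization _ Pp; have Lmod := localization_submodule _ Pp.
  have Lg : poly_over (localization D P) g by move=> j; apply: DL.
  exists f, g; split=> //; first by move=> j; apply: DL.
  apply/seteqP; split; first exact: content_sub.
  move=> x Lx; have gi0 := prime_ideal_compl_neq0 _ _ Pp nPi.
  have [_ _ CZ] := gen_submoduleP (localization D P) (range (fun i : nat => g`_i)).
  rewrite -[x](mulfVK gi0); apply: CZ; last exact: coef_content.
  have [_ _ LM] := Lmod; apply: LM => //.
  by exists 1, g`_i; split; rewrite ?div1r.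
Qed.

(** A denominator [s] outside [P] is also one for polynomials, as a constant;
    conversely, any coefficient outside [P] of a denominator [g] of the
    constant [x] is a denominator of [x]. *)
Lemma const_fraction_localization P E x : D (- 1) -> prime_ideal D P ->
  submodule D E ->
  fractions E (outside P) (const_ratfun x) <->
  gen_submodule (localization D P) E x.
Proof.
move=> DN1 Pp Emod; have [_ out_neq0 _ _] := outside_mulset _ DN1 Pp; split.
  move=> /(const_fraction D _ _ _ Emod out_neq0)[g [Dg [i nPi]] Egx].
  by apply/(gen_localizationP _ _ _ Pp Emod); exists g`_i.
move=> /(gen_localizationP _ _ _ Pp Emod)[s [Ds nPs Esx]].
exists (s * x)%:P, s%:P; split; first exact: (poly_overC D).
  by split; [apply: (poly_overC D)|exists 0%N; rewrite coefC].
rewrite polyCM poly_ratfunM mulrC mulKf //.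
by rewrite poly_ratfun_eq0 polyC_eq0 (prime_ideal_compl_neq0 P).
Qed.

(** Intersecting the extensions to the localizations at a set of primes is a
    semistar operation: idempotence holds because [E D_P], which contains the
    intersection, is already closed under the denominators of [D_P]. *)
Lemma star_sp_semistar star : semistar D (star_sp D star).
Proof.
have primeP P : Pi_star D star P -> prime_ideal D P by case.
have ext E : E `<=` star_sp D star E.
  by move=> x Ex P _; apply: sub_gen.
have mono E F : E `<=` F -> star_sp D star E `<=` star_sp D star F.
  by move=> EF x Ex P /Ex; apply: gen_mono.
have FbarE E : Fbar D E -> Fbar D (star_sp D star E).
  move=> FE; have [x Ex x0] := Fbar_neq0 _ FE.
  apply: (FbarP _ x) => //; last exact: ext.
  have locmod P : Pi_star D star P ->
      submodule D (gen_submodule (localization D P) E).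
    move=> /primeP Pp; have [G0 GA GZ] := gen_submoduleP (localization D P) E.
    by split=> // a y /(sub_localization _ Pp); apply: GZ.
  split.
  - by move=> P /locmod[].
  - by move=> a b Ea Eb P PP; have [_ + _] := locmod _ PP; apply; [apply: Ea|apply: Eb].
  - by move=> a b Da Eb P PP; have [_ _] := locmod _ PP; apply=> //; apply: Eb.
split=> //.
- move=> z E z0 [Emod _]; apply/seteqP; split=> x.
    move=> zEx; exists (z^-1 * x); last by rewrite mulVKf.
    move=> P PP; have := zEx P PP; rewrite -gen_scale => -[y Ey <-].
    by rewrite mulKf.
  by move=> [y Ey <-] P PP; rewrite -gen_scale; exists y => //; apply: Ey.
- by move=> E F _ _; apply: mono.
- move=> E FE; apply/seteqP; split; last exact: ext.
  move=> x Ex P PP; have Pp := primeP _ PP; have [Emod _] := FE.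
  have [spmod _] := FbarE _ FE.
  have [s [Ds nPs sx]] := (gen_localizationP _ _ _ Pp spmod).1 (Ex P PP).
  have [t [Dt nPt tsx]] := (gen_localizationP _ _ _ Pp Emod).1 (sx P PP).
  apply/(gen_localizationP _ _ _ Pp Emod); exists (t * s); split.
  + by case: Dmod => _ _; apply.
  + exact: prime_ideal_complM.
  + by rewrite -mulrA.
Qed.

End Localization.

(** * The Nagata ring of a semistar operation *)

Section NagataStar.

Local Open Scope ring_scope.
Import GRing.Theory.

Context {K : fieldType} {D : set K} {star : set K -> set K}.
Hypotheses (Dmod : submodule D D) (D1 : D 1) (DN1 : D (- 1)).
Hypothesis star_ss : semistar D star.
Hypothesis M_neq0 : exists Q, quasi_maximal D (star_fin D star) Q.
Implicit Types (E Q : set K).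

Let M := quasi_maximal D (star_fin D star).

Let M_prime Q : M Q -> prime_ideal D Q.
Proof. exact: quasi_maximal_prime. Qed.

Definition outside_all : set {poly K} := \bigcap_(Q in M) outside (D := D) Q.

Lemma outside_all_mulset : mulset D outside_all.
Proof.
have mulP Q : M Q -> mulset D (outside (D := D) Q).
  by move=> /M_prime; apply: outside_mulset.
have [Q0 MQ0] := M_neq0; have [sub0 neq0 _ _] := mulP _ MQ0; split.
- by move=> g /(_ _ MQ0); apply: sub0.
- by move=> g /(_ _ MQ0); apply: neq0.
- by move=> Q /mulP[].
- move=> g1 g2 S1 S2 Q MQ; have [_ _ _] := mulP _ MQ.
  by apply; [apply: S1|apply: S2].
Qed.

Lemma star_content1_outside_all g : g != 0 -> poly_over D g ->
  star (content D g) 1 -> outside_all g.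
Proof.
move=> g0 Dg c1 Q MQ; split=> //; apply: contrapT => /forallNP nQg.
apply: (quasi_maximal_not1 D1 _ MQ); exists (content D g) => //; split.
  exact: fg_content.
apply: content_sub; first by case: (quasi_maximal_Fbar _ MQ).
by move=> i; apply: contrapT.
Qed.

(** With [star_content1_outside_all], identifies the denominators allowed in
    [Na D star].  The content of [g] lies in no quasi-maximal ideal, so its closure has to
    contain [1]. *)
Lemma outside_all_star g : outside_all g -> star (content D g) = star D.
Proof.
move=> Sg; have [Sub neq0 _ _] := outside_all_mulset.
have g0 := neq0 _ Sg; have Dg := Sub _ Sg; have fgc := fg_content (D := D) g g0.
have Fc := Fbar_fg _ fgc; have FD := Fbar_D Dmod D1.
have cD : content D g `<=` D by apply: content_sub.
have c1 : star (content D g) 1.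
  apply: contrapT => nc1.
  have [|Q MQ cQ] := exists_quasi_maximal Dmod D1 star_ss _ Fc cD.
    by move=> /(star_fin_sub star_ss _ Fc).
  by have [_ [i]] := Sg Q MQ; apply; apply: cQ; apply: coef_content.
apply/seteqP; split; first exact: (semistar_mono star_ss).
have Fsc := semistar_Fbar star_ss Fc.
rewrite -[X in _ `<=` X](semistar_idem star_ss Fc).
apply: (semistar_mono star_ss) => // a Da; rewrite -[a]mulr1.
by have [[_ _ +] _] := Fsc; apply.
Qed.

Lemma NaE : Na D star = fractions D outside_all.
Proof.
have [Sub neq0 _ _] := outside_all_mulset.
apply/seteqP; split=> [_ [f [g [Df Dg g0 cg ->]]]|_ [f [g [Df Sg ->]]]].
  exists f, g; split=> //; apply: star_content1_outside_all => //.
  by rewrite cg; apply: (semistar_ext star_ss (Fbar_D Dmod D1)).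
exists f, g; split=> //; [exact: Sub|exact: neq0|exact: outside_all_star].
Qed.

Lemma extend_Na E : submodule D E -> extend E (Na D star) = fractions E outside_all.
Proof. by move=> Emod; rewrite NaE extend_fractions //; apply: outside_all_mulset. Qed.

Lemma extend_nagata E Q : submodule D E -> M Q ->
  extend E (nagata_ring (localization D Q)) = fractions E (outside (D := D) Q).
Proof.
move=> Emod MQ; rewrite nagata_localization ?extend_fractions //.
  by apply: outside_mulset => //; apply: M_prime.
exact: M_prime.
Qed.

(** The local-global principle behind (1): the denominators of [u] that work
    for the various [Q] are merged into a single one, valid for all [Q]. *)
Lemma fractions_outside_all E : submodule D E ->
  fractions E outside_all = \bigcap_(Q in M) fractions E (outside (D := D) Q).
Proof.
move=> Emod; have [E0 _ _] := Emod; apply/seteqP; split.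
  by move=> u Eu Q MQ; apply: fractions_sub Eu => // g; apply.
move=> u Mu; pose J := [set g : {poly K} | poly_over D g /\
  exists2 h, poly_over E h & poly_ratfun g * u = poly_ratfun h].
pose C := [set content D g | g in J].
have Cmod N : C N -> submodule D N by move=> [g _ <-]; apply: gen_submoduleP.
have dirC : directed C.
  split.
    exists (content D 0), 0 => //; split; first by move=> i; rewrite coef0; case: Dmod.
    exists 0; first by move=> i; rewrite coef0.
    by rewrite [poly_ratfun 0]tofrac0 mul0r.
  move=> _ _ [g1 [Dg1 [h1 Eh1 gu1]] <-] [g2 [Dg2 [h2 Eh2 gu2]] <-].
  have DX : poly_over D 'X^(size g1) by apply: poly_overXn.
  (* The shift by [size g1] keeps the coefficients of [g1] and [g2] apart. *)
  have coefg i : (g1 + 'X^(size g1) * g2)`_i =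
      if (i < size g1)%N then g1`_i else g2`_(i - size g1).
    rewrite coefD coefXnM; case: ltnP => [_|gi]; first by rewrite addr0.
    by rewrite nth_default // add0r.
  exists (content D (g1 + 'X^(size g1) * g2)).
    exists (g1 + 'X^(size g1) * g2) => //; split.
      by apply: (poly_overD D) => //; apply: (poly_overM D).
    exists (h1 + 'X^(size g1) * h2).
      by apply: (poly_overD D) => //; apply: (poly_overM D).
    by rewrite !(poly_ratfunD, poly_ratfunM) mulrDl gu1 -mulrA gu2.
  have Gmod := gen_submoduleP D (range (fun i : nat => (g1 + 'X^(size g1) * g2)`_i)).
  have G0 : content D (g1 + 'X^(size g1) * g2) 0 by case: Gmod.
  split; apply: content_sub => // i.
  - have [ig|gi] := ltnP i (size g1); last by rewrite nth_default.
    by have := coef_content D (g1 + 'X^(size g1) * g2) i; rewrite coefg ig.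
  - have := coef_content D (g1 + 'X^(size g1) * g2) (i + size g1).
    by rewrite coefg ltnNge leq_addl addnK.
pose I := \bigcup_(N in C) N.
have Imod : submodule D I by apply: submodule_bigcup_directed.
have ID : I `<=` D.
  by move=> x [_ [g [Dg _] <-]]; apply: content_sub.
have InQ Q : M Q -> exists2 x, I x & ~ Q x.
  move=> MQ; have [h [g [Eh [Dg [i nQi]] uE]]] := Mu Q MQ.
  exists g`_i => //; exists (content D g); last exact: coef_content.
  exists g => //; split=> //; exists h => //.
  have [_ neq0 _ _] := outside_mulset Dmod D1 _ DN1 (M_prime _ MQ).
  rewrite uE mulrC divfK // poly_ratfun_eq0; apply: neq0.
  by split=> //; exists i.
have FI : Fbar D I.
  have [Q0 MQ0] := M_neq0; have [x Ix nQx] := InQ _ MQ0.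
  by apply: (FbarP _ x) => //; apply: (prime_ideal_compl_neq0 Q0) => //; apply: M_prime.
have [F [fgF FI'] F1] : star_fin D star I 1.
  apply: contrapT => nI1.
  have [Q MQ IQ] := exists_quasi_maximal Dmod D1 star_ss _ FI ID nI1.
  by have [x /IQ] := InQ _ MQ.
have [_ [g [Dg [h Eh guh]] <-] Fg] := fg_sub_directed _ _ fgF dirC Cmod FI'.
have Sg : outside_all g.
  move=> Q MQ; split=> //; apply: contrapT => /forallNP nQg.
  apply: (quasi_maximal_not1 D1 _ MQ); exists F => //; split=> //.
  apply: (subset_trans Fg); apply: content_sub.
    by case: (quasi_maximal_Fbar _ MQ).
  by move=> i; apply: contrapT.
exists h, g; split=> //.
have [_ neq0 _ _] := outside_all_mulset.
by rewrite -guh mulrC mulKf // poly_ratfun_eq0 neq0.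
Qed.

Lemma contract_fractions_outside_all E : submodule D E ->
  contract (fractions E outside_all) =
  \bigcap_(Q in M) gen_submodule (localization D Q) E.
Proof.
move=> Emod; rewrite fractions_outside_all //; apply/seteqP; split=> x Mx Q MQ.
  exact: (const_fraction_localization Dmod D1 _ _ _ DN1 (M_prime _ MQ) Emod).1 (Mx Q MQ).
exact: (const_fraction_localization Dmod D1 _ _ _ DN1 (M_prime _ MQ) Emod).2 (Mx Q MQ).
Qed.

(** Every prime of [Pi_star] lies below a quasi-maximal ideal, and localizing at
    the larger prime gives a smaller extension, so the quasi-maximal ideals
    suffice. *)
Lemma star_tildeE E :
  star_tilde D star E = \bigcap_(Q in M) gen_submodule (localization D Q) E.
Proof.
apply/seteqP; split=> x.
  move=> Px Q MQ; apply: Px; have [[Qid Q0 QE] QD _] := MQ.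
  by split; [apply: M_prime| |rewrite QE].
move=> Mx P [Pp P0 fPD]; have [Pid _ _] := Pp; have [Pmod PsubD] := Pid.
have FP : Fbar D P by split.
have nP1 := (star_fin_proper D1 star_ss P FP).1 fPD.
have [Q MQ PQ] := exists_quasi_maximal Dmod D1 star_ss _ FP PsubD nP1.
by apply: gen_mono (Mx Q MQ) => //; apply: localization_anti.
Qed.

(** [x g] in [E[X]] means that [x c(g)] is contained in [E], and the closure of
    [x c(g)] is [x (star D)]. *)
Lemma contract_fractions_star E : Fbar D E ->
  contract (fractions E outside_all) `<=` star E.
Proof.
move=> FE x; have [Emod _] := FE; have [Sub neq0 _ _] := outside_all_mulset.
move=> /(const_fraction D _ _ _ Emod neq0)[g Sg Egx].
have [->|x0] := eqVneq x 0; first by have [[]] := semistar_Fbar star_ss FE.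
have Fc := Fbar_fg _ (fg_content (D := D) g (neq0 _ Sg)).
apply: (semistar_mono star_ss (Fbar_scale _ _ x0 Fc) FE).
  rewrite gen_scale; apply: gen_min => // _ [_ [i _ <-] <-].
  by rewrite mulrC; apply: Egx.
rewrite (semistar_scale star_ss x0 Fc) (outside_all_star _ Sg).
by exists 1; rewrite ?mulr1 //; apply: (semistar_ext star_ss (Fbar_D Dmod D1)).
Qed.

(** A constant of the form [h / g] with [h] in [E[X]] and [g] in
    [outside_all] is still such a fraction over the submodule generated by the
    coefficients of [h]. *)
Lemma star_tilde_finite_type : finite_type D (star_tilde D star).
Proof.
have contractE E : submodule D E ->
    star_tilde D star E = contract (fractions E outside_all).
  by move=> Emod; rewrite star_tildeE contract_fractions_outside_all.
move=> E FE; have [Emod _] := FE; apply/seteqP; split.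
  move=> x; rewrite contractE // => -[h [g [Eh Sg xE]]].
  have [e Ee e0] := Fbar_neq0 _ FE.
  (* The extra generator [e] keeps [F] nonzero when [h = 0]. *)
  pose F := gen_submodule D ([set e] `|` range (fun i : nat => h`_i)).
  have Fmod : submodule D F by apply: gen_submoduleP.
  exists F; last first.
    rewrite contractE //; exists h, g; split=> // i.
    by apply: sub_gen; right; exists i.
  split.
    apply: (fg_gen _ e) => //; last by left.
    by rewrite finite_setU; split=> //; apply: finite_coefs.
  by apply: gen_min => // _ [->//|[i _ <-]]; apply: Eh.
move=> x [F [_ FE'] Fx]; rewrite star_tildeE => Q MQ.
by move: Fx; rewrite star_tildeE => /(_ Q MQ); apply: gen_mono.
Qed.

End NagataStar.

(** * Operations that agree on nonzero submodules *)

Section FiniteType.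

Context {K : fieldType} {D : set K} {star : set K -> set K}.

Lemma eq_star_quasi_maximal star' : eq_star D star star' ->
  quasi_maximal D star = quasi_maximal D star'.
Proof.
move=> eqs.
have quasiE I : quasi_ideal D star I = quasi_ideal D star' I.
  by apply/propext; split=> -[Iid I0 IE]; split=> //; move: IE;
    rewrite eqs //; case: Iid.
apply/funext => Q; apply/propext; split=> -[qQ QD maxQ].
  by split=> //; [rewrite -quasiE|move=> J; rewrite -quasiE; apply: maxQ].
by split=> //; [rewrite quasiE|move=> J; rewrite quasiE; apply: maxQ].
Qed.

Lemma eq_star_sp star' : eq_star D star star' -> star_sp D star = star_sp D star'.
Proof.
move=> eqs; suff PiE : Pi_star D star = Pi_star D star' by rewrite /star_sp PiE.
apply/funext => P; apply/propext; split=> -[Pp P0 PD]; split=> //; move: PD;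
  by rewrite eqs //; case: Pp => -[].
Qed.

End FiniteType.

(** * A domain inside its quotient field *)

Section Base.

Local Open Scope ring_scope.
Import GRing.Theory.

Lemma base_submodule (A : idomainType) : submodule (base A) (base A).
Proof.
split; first by exists 0%R => //; apply: tofrac0.
- by move=> _ _ [a _ <-] [b _ <-]; exists (a + b)%R => //; apply: tofracD.
- by move=> _ _ [a _ <-] [b _ <-]; exists (a * b)%R => //; apply: tofracM.
Qed.

Lemma base_fraction (A : idomainType) (x : {fraction A}) :
  exists a b, [/\ base A a, base A b, (b != 0)%R & x = (a / b)%R].
Proof.
elim/generic_quotient.quotW: x => r; have d0 := denom_ratioP r.
have dF0 : FracField.tofrac (frac r).2 != 0 by rewrite tofrac_eq0.
exists (FracField.tofrac (frac r).1), (FracField.tofrac (frac r).2).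
split=> //; [by eexists|by eexists|].
apply: (mulIf dF0); rewrite divfK //.
unlock FracField.tofrac; rewrite -[LHS]FracField.pi_mul.
apply/eqP; rewrite FracField.equivf_def /FracField.mulf.
rewrite !numer_Ratio ?denom_Ratio ?mulf_neq0 ?oner_neq0 //.
by rewrite !mulr1 mulrC.
Qed.

End Base.

Theorem proposition3p4 (A : idomainType)
    (star : set {fraction A} -> set {fraction A}) :
  let D := base A in
  semistar D star -> ~ trivial_star D star ->
  (forall E : set {fraction A}, Fbar D E ->
    [/\ (* (1) *)
        extend E (Na D star) =
          \bigcap_(Q in quasi_maximal D (star_fin D star))
             extend E (nagata_ring (localization D Q)),
        (* (2) *)
        contract (extend E (Na D star)) =
          \bigcap_(Q in quasi_maximal D (star_fin D star))
             gen_submodule (localization D Q) E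
      & (* (3) *)
        star_tilde D star E =
          contract (extend E (Na D star)) /\
        (E = star E ->
          E = contract (extend E (Na D star)))]) /\
  (* (4) *)
  (eq_star D star (star_fin D star) ->
    [/\ eq_star D (star_tilde D star) (star_sp D star),
        star_sp D star D =
          \bigcap_(Q in quasi_maximal D star) localization D Q,
        semistar D (star_sp D star)
      & finite_type D (star_sp D star)]).
Proof.
move=> D star_ss nontriv.
have Dmod : submodule D D := base_submodule A.
have D1 : D 1%R by exists 1%R => //; apply: tofrac1.
have DN1 : D (- 1)%R by exists (- 1)%R => //; rewrite tofracN tofrac1.
have M_neq0 := exists_quasi_maximal_nontrivial Dmod D1 star_ss
  (@base_fraction A) nontriv.
have Mprime := quasi_maximal_prime Dmod D1 star_ss.
split=> [E FE|star_fE].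
  have [Emod _] := FE; rewrite extend_Na //.
  have contractE := contract_fractions_outside_all Dmod D1 DN1 star_ss M_neq0 _ Emod.
  split; [|exact: contractE|split].
  - rewrite fractions_outside_all //; apply: eq_bigcapr => Q MQ.
    by rewrite (extend_nagata Dmod D1 DN1 star_ss _ _ Emod MQ).
  - by rewrite contractE star_tildeE.
  - move=> Est; apply/seteqP; split; last first.
      by rewrite [X in _ `<=` X]Est; apply: contract_fractions_star.
    by rewrite contractE => x Ex Q _; apply: sub_gen.
have spE : star_sp D star = star_tilde D star := eq_star_sp _ star_fE.
split.
- by rewrite spE.
- rewrite spE star_tildeE // (eq_star_quasi_maximal _ star_fE).
  by apply: eq_bigcapr => Q /Mprime; apply: gen_localization_D.
- exact: star_sp_semistar.
- by rewrite spE; apply: star_tilde_finite_type.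
Qed.
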